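(* Let $F$ be a forest of order $n$ with no isolated vertex and with total domination number $\gamma_t$. Then the number $\sharp\gamma_t(F)$ of minimum total dominating sets of $F$ satisfies $$\sharp\gamma_t(F)\leq \left(8\sqrt{e}\,\right)^{\gamma_t}\left(\frac{n-\frac{\gamma_t}{2}}{\frac{\gamma_t}{2}}\right)^{\frac{\gamma_t}{2}},$$ where $e$ is Euler's number (the base of the natural logarithm).
   Context: Graphs are finite, simple, undirected, and have at least one vertex; the order of a graph is its number of vertices; a forest is an acyclic graph. A set $D$ of vertices of a graph $G$ is a total dominating set of $G$ if every vertex of $G$ (including those in $D$) has a neighbor in $D$. The total domination number $\gamma_t(G)$ is the minimum cardinality of a total dominating set of $G$ (one exists when $G$ has no isolated vertex). A minimum total dominating set is a total dominating set of cardinality $\gamma_t(G)$, and $\sharp\gamma_t(G)$ denotes the number of minimum total dominating sets of $G$. *)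

(* Defs.v *)
From mathcomp Require Import all_boot.

Set Implicit Arguments.
Unset Strict Implicit.
Unset Printing Implicit Defensive.

(* A finite simple graph is a symmetric irreflexive relation [e] on a
   finite type [T] of vertices; its order is [#|T|]. *)
Definition simple_graph (T : finType) (e : rel T) : Prop :=
  symmetric e /\ irreflexive e.

(* [ucycle e c] also holds of [[::]] and of [[:: x; y]] for an edge [x y],
   neither of which is a cycle of the graph, hence the bound on [size c]. *)
Definition acyclic (T : finType) (e : rel T) : Prop :=
  forall c : seq T, 2 < size c -> ~ ucycle e c.

Definition forest (T : finType) (e : rel T) : Prop :=
  simple_graph e /\ acyclic e.

Definition no_isolated_vertex (T : finType) (e : rel T) : Prop :=
  forall v : T, exists w : T, e v w.

Definition total_dominating (T : finType) (e : rel T) (D : {set T}) : bool :=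
  [forall v, exists w in D, e v w].

(* [setT] is only the starting point of the search; without isolated vertices
   it is itself totally dominating, so the arg min is a genuine minimum (see
   [total_domination_numberP]). *)
Definition total_domination_number (T : finType) (e : rel T) : nat :=
  #|[arg min_(D < [set: T] | total_dominating e D) #|D|]|.

Lemma total_domination_numberP (T : finType) (e : rel T) :
  no_isolated_vertex e ->
  (exists2 D, total_dominating e D & #|D| = total_domination_number e) /\
  (forall D, total_dominating e D -> total_domination_number e <= #|D|).
Proof.
move=> e_noiso; rewrite /total_domination_number.
case: arg_minnP => [|D domD minD]; last by split=> //; exists D.
apply/forallP=> v; have [w evw] := e_noiso v.
by apply/existsP; exists w; rewrite inE.
Qed.

Definition min_total_dominating_sets (T : finType) (e : rel T) :
    {set {set T}} :=
  [set D : {set T} |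
    total_dominating e D & #|D| == total_domination_number e].

(* Main.v *)
Require Import Defs.
From mathcomp Require Import all_boot all_order all_algebra.
From mathcomp Require Import reals sequences exp.

(** In a forest, packing and total domination are dual: there is a set [P] of
    [gamma] vertices with pairwise disjoint neighbourhoods.  A minimum total
    dominating set [D] has [gamma] elements and meets each of these
    neighbourhoods, so it picks exactly one vertex in each and nothing else.
    Hence there are at most [\prod_(p in P) #|neighbours e p|] such sets
    ([min_total_dominating_sets_le_prod]).  As these degrees sum to at most
    [n], this alone gives [(n / gamma) ^ gamma]; the exponent [gamma / 2]
    comes from choosing [P] well.

    List the vertices so that each has at most one later neighbour, its parent
    ([forest_elimination_order]).  Scan them in this order: a vertex that is
    not yet dominated is put in [P], and its parent becomes a dominator.
    The neighbourhoods of the vertices of [P] are then disjoint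
    ([greedy_packing]), and the dominators show that [P] has [gamma] elements
    ([greedy_card]).

    Call a vertex of [P] upper if one of its children is in [P].
    - A child in [P] of an upper vertex [p] is not upper, since a child
      of that child in [P] would have made it a dominator of [p] before [p] was
      scanned.  So at most half of [P] is upper ([upper_double]).
    - If [q] in [P] is not upper, then each of its children was already
      dominated when it was scanned, and not by [q], which is the parent of no
      vertex of [P].  So the child was dominated by one of its own
      children, which is the parent of a vertex of [P].  The degree of [q] thus
      exceeds by at most one its number of great-grandchildren in [P], and the
      product of these degrees is at most [2 ^ gamma] ([prod_lower_degree]).

    So the number of minimum total dominating sets is at most [2 ^ gamma] times
    a product of at most [gamma / 2] degrees whose sum is at most [n].  The
    inequality [d <= a * expR (d / a)], with [a] twice the base of the power in
    the bound, turns this into the result. *)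

Set Implicit Arguments.
Unset Strict Implicit.
Unset Printing Implicit Defensive.

Import Order.TTheory GRing.Theory Num.Theory.

(** * Elimination orders and greedy scans *)

(** If every vertex of [S] had two neighbours in [S], any path in [S] could be
    extended at its head without stepping back: the new vertex is not on the
    path, since it would close a cycle.  So paths would grow for ever. *)
Lemma acyclic_leaf (T : finType) (e : rel T) (S : {set T}) (v0 : T) :
  forest e -> v0 \in S ->
  exists2 v, v \in S & {in S &, forall x y, e v x -> e v y -> x = y}.
Proof.
move=> [[e_sym e_irr] e_acyclic] Sv0.
pose leaf v := [forall x in S, forall y in S, e v x ==> e v y ==> (x == y)].
have [v /andP[Sv leafv]|noleaf] := pickP (fun v => (v \in S) && leaf v).
  exists v => // x y Sx Sy evx evy.
  move: leafv => /forall_inP/(_ x Sx)/forall_inP/(_ y Sy).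
  by rewrite evx evy /= => /eqP.
have next v u : v \in S -> exists z, [/\ z \in S, e v z & z != u].
  move=> Sv; move: (noleaf v); rewrite Sv /= => /negbT.
  rewrite negb_forall => /existsP[x]; rewrite negb_imply => /andP[Sx].
  rewrite negb_forall => /existsP[y]; rewrite negb_imply => /andP[Sy].
  rewrite !negb_imply => /and3P[evx evy neq_xy].
  have [xu|] := eqVneq x u; last by exists x.
  by exists y; split; rewrite // -xu eq_sym.
have long k : exists x p,
    [/\ size p = k, uniq (x :: p), path e x p & x \in S].
  elim: k => [|k [x [p [sz_p uniq_xp path_p Sx]]]]; first by exists v0, [::].
  have [z [Sz exz neq_z]] := next x (head x p) Sx.
  exists z, (x :: p); split; rewrite //= ?sz_p // ?(e_sym z) ?exz //.
  rewrite -/(uniq (x :: p)) uniq_xp andbT.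
  apply/negP; rewrite in_cons => /predU1P[zx|pz].
    by rewrite zx e_irr in exz.
  case/splitPr: pz sz_p uniq_xp path_p neq_z => p1 p2 _ uniq_c path_c neq_z.
  (* [p1] is not empty because [z] is not the second vertex of the path; this
     makes the cycle [x, p1, z] longer than two. *)
  apply: (e_acyclic (x :: rcons p1 z)).
    by case: p1 neq_z {uniq_c path_c} => [|? ?] //=; rewrite ?eqxx // size_rcons.
  apply/andP; split.
    rewrite /= rcons_path last_rcons (e_sym z) exz andbT.
    by move: path_c; rewrite -cat_rcons cat_path => /andP[].
  by move: uniq_c; rewrite -cat_rcons -cat_cons cat_uniq => /andP[].
have [x [p [sz_p uniq_xp _ _]]] := long #|T|.
by move/card_uniqP: uniq_xp (max_card [in x :: p]) => ->; rewrite /= sz_p ltnn.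
Qed.

(** Remove a vertex with at most one remaining neighbour, again and again; [h]
    is the time of removal. *)
Lemma forest_elimination_order (T : finType) (e : rel T) :
  forest e ->
  exists2 h : T -> nat, injective h &
    forall v x y, e v x -> h v < h x -> e v y -> h v < h y -> x = y.
Proof.
move=> forest_e.
suff elim_S k : forall S : {set T}, #|S| = k ->
    exists2 h : T -> nat, {in S &, injective h} &
      forall v x y, v \in S -> x \in S -> y \in S ->
        e v x -> h v < h x -> e v y -> h v < h y -> x = y.
  have [h h_inj hE] := elim_S _ [set: T] erefl.
  exists h => [x y|v x y]; first by apply: h_inj; rewrite inE.
  by apply: hE; rewrite inE.
elim: k => [|k IH] S cardS.
  exists (fun=> 0) => [x|v]; have -> : S = set0 by apply: cards0_eq.
    by rewrite inE.
  by move=> ? ?; rewrite inE.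
have /card_gt0P[v0 Sv0] : 0 < #|S| by rewrite cardS.
have [u Su leaf_u] := acyclic_leaf forest_e Sv0.
have [|h h_inj hE] := IH (S :\ u).
  by move: cardS; rewrite (cardsD1 u) Su => -[].
have inSu x : x \in S -> x != u -> x \in S :\ u.
  by rewrite !inE => -> ->.
exists (fun x => if x == u then 0 else (h x).+1)
  => [x y Sx Sy|v x y Sv Sx Sy evx].
  have [->|xu] := eqVneq x u; have [->|yu] := eqVneq y u => //.
  by move=> [hxy]; apply: h_inj hxy; apply: inSu.
have [xu|xu] := eqVneq x u; first by [].
have [yu|yu] := eqVneq y u; first by [].
have [vu _ evy _|vu hvx evy hvy] := eqVneq v u.
  by rewrite vu in evx evy; exact: leaf_u.
by apply: hE evx hvx evy hvy; apply: inSu.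
Qed.

(** This is the outcome of a greedy scan in the order of [h], [c y p] meaning
    that the choice of [y] rules out [p].  It is built by stages: a set which
    obeys the equation below rank [k] yields one which obeys it below [k.+1]
    when the right-hand side is used as its definition. *)
Lemma kernel_exists (T : finType) (h : T -> nat) (c : rel T) :
  exists P : {set T}, forall p,
    (p \in P) = ~~ [exists y in P, (h y < h p) && c y p].
Proof.
suff kernel_below k : exists P : {set T}, forall p, h p < k ->
    (p \in P) = ~~ [exists y in P, (h y < h p) && c y p].
  have [P PE] := kernel_below (\max_p h p).+1.
  by exists P => p; apply: PE; rewrite ltnS; apply: leq_bigmax.
elim: k => [|k [P PE]]; first by exists set0.
exists [set p | ~~ [exists y in P, (h y < h p) && c y p]] => p ltpk.
rewrite inE; congr (~~ _); apply: eq_existsb => y.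
have [ltyp|] := ltnP (h y) (h p); last by rewrite !andbF.
by rewrite inE -PE // (leq_trans ltyp).
Qed.

(** * Packings and minimum total dominating sets *)

Definition neighbours (T : finType) (e : rel T) (v : T) : {set T} :=
  [set w | e v w].

Definition open_packing (T : finType) (e : rel T) (P : {set T}) : Prop :=
  forall p q x, p \in P -> q \in P -> e p x -> e q x -> p = q.

Lemma open_packing_le (T : finType) (e : rel T) (P D : {set T}) :
  open_packing e P -> total_dominating e D -> #|P| <= #|D|.
Proof.
move=> packP /forallP domD.
have domP p : exists x, (x \in D) && e p x.
  by have /exists_inP[x Dx epx] := domD p; exists x; rewrite Dx.
pose f p := xchoose (domP p).
have fP p : (f p \in D) && e p (f p) := xchooseP (domP p).
have /card_in_imset <- : {in P &, injective f}.
  move=> p q Pp Pq fpq; apply: (packP p q (f p)) => //.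
    by have /andP[] := fP p.
  by rewrite fpq; have /andP[] := fP q.
apply: subset_leq_card; apply/subsetP=> _ /imsetP[p _ ->].
by have /andP[] := fP p.
Qed.

(** A minimum total dominating set [D] meets each of the disjoint
    neighbourhoods of [P] and has no more elements than [P]; so it is the
    image of [P] under any choice of a vertex of [D] in each of them, and the
    choice functions are counted by the product. *)
Lemma min_total_dominating_sets_le_prod (T : finType) (e : rel T) (P : {set T}) :
  open_packing e P -> #|P| = total_domination_number e ->
  #|min_total_dominating_sets e| <= \prod_(p in P) #|neighbours e p|.
Proof.
move=> packP cardP.
(* The choice functions are made total by fixing the vertices outside [P]. *)
pose F p := if p \in P then neighbours e p else [set p].
have -> : \prod_(p in P) #|neighbours e p| = #|[in family F]|.
  rewrite card_family foldrE big_map big_enum /= big_mkcond /=.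
  by apply: eq_bigr => p _; rewrite /F; case: ifP => //; rewrite cards1.
apply: leq_trans (leq_imset_card (fun g : {ffun T -> T} => g @: P) _).
apply: subset_leq_card; apply/subsetP=> D.
rewrite inE => /andP[/forallP domD /eqP cardD].
have domP p : exists x, (x \in D) && e p x.
  by have /exists_inP[x Dx epx] := domD p; exists x; rewrite Dx.
pose f p := xchoose (domP p).
have fP p : (f p \in D) && e p (f p) := xchooseP (domP p).
have fD p : f p \in D by have /andP[] := fP p.
have ef p : e p (f p) by have /andP[] := fP p.
pose g := [ffun p => if p \in P then f p else p].
have gE : {in P, g =1 f} by move=> p Pp; rewrite ffunE Pp.
apply/imsetP; exists g.
  apply/familyP=> p; rewrite /F ffunE.
  by case: ifP => _; rewrite !inE.
apply/esym/eqP; rewrite (eq_in_imset gE) eqEcard; apply/andP; split.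
  by apply/subsetP=> _ /imsetP[p _ ->].
rewrite card_in_imset ?cardD ?cardP // => p q Pp Pq fpq.
by apply: (packP p q (f p)) => //; rewrite fpq.
Qed.

Lemma sum_neighbours_packing (T : finType) (e : rel T) (P : {set T}) :
  open_packing e P -> \sum_(p in P) #|neighbours e p| <= #|T|.
Proof.
move=> packP; under eq_bigr do rewrite -sum1_card.
rewrite (exchange_big_dep xpredT) //= -sum1_card; apply: leq_sum => x _.
have [p /andP[Pp px]|none] :=
  pickP (fun p => (p \in P) && (x \in neighbours e p)); last first.
  by rewrite big_pred0.
rewrite (big_pred1 p) // => q; apply/andP/eqP => [[Pq qx]|->] //.
by move: px qx; rewrite !inE => px qx; apply: packP Pq Pp qx px.
Qed.

(** * The greedy packing of a forest *)

Section GreedyPacking.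

Variables (T : finType) (e : rel T) (h : T -> nat).
Hypothesis e_graph : simple_graph e.
Hypothesis e_noiso : no_isolated_vertex e.
Hypothesis h_inj : injective h.
Hypothesis later_uniq :
  forall v x y, e v x -> h v < h x -> e v y -> h v < h y -> x = y.

(** Vertices without a later neighbour are made their own parents, so that
    [h v < h (parent v)] tells whether the parent is genuine. *)
Definition parent (v : T) : T := odflt v [pick w | e v w && (h v < h w)].

Lemma parentE v w : e v w -> h v < h w -> parent v = w.
Proof.
move=> evw ltvw; rewrite /parent; case: pickP => [x /andP[evx ltvx]|/(_ w)].
  exact: later_uniq evx ltvx evw ltvw.
by rewrite evw ltvw.
Qed.

Lemma parent_edge v : h v < h (parent v) -> e v (parent v).
Proof. by rewrite /parent; case: pickP => [x /andP[]|] //=; rewrite ltnn. Qed.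

(** Once [y] is in the packing its parent is a dominator; so [p] needs no
    dominator of its own if it is next to that parent. *)
Definition blocks (y p : T) : bool := (h y < h (parent y)) && e p (parent y).

Variable P : {set T}.
Hypothesis PE : forall p,
  (p \in P) = ~~ [exists y in P, (h y < h p) && blocks y p].

Lemma greedy_unblocked p y : p \in P -> y \in P -> h y < h p -> ~~ blocks y p.
Proof.
move=> Pp Py ltyp; apply/negP=> byp; move: Pp; rewrite PE => /negP[].
by apply/exists_inP; exists y; rewrite // ltyp.
Qed.

Lemma greedy_blocked p : p \notin P ->
  exists y, [/\ y \in P, h y < h p, h y < h (parent y) & e p (parent y)].
Proof.
by rewrite PE negbK => /exists_inP[y Py /and3P[? ? ?]]; exists y.
Qed.

(** Let [p] come before [q] in [P], with a common neighbour [x].  If [x] is the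
    parent of [p], then [p] blocks [q]; otherwise [p] and [q] are both later
    than [x], so both are its parent. *)
Lemma greedy_packing : open_packing e P.
Proof.
have [e_sym e_irr] := e_graph.
have aux p q x : p \in P -> q \in P -> e p x -> e q x -> ~~ (h p < h q).
  move=> Pp Pq epx eqx; apply/negP=> ltpq.
  have [ltpx|] := ltnP (h p) (h x).
    have := greedy_unblocked Pq Pp ltpq.
    by rewrite /blocks (parentE epx ltpx) ltpx eqx.
  rewrite leq_eqVlt => /predU1P[/h_inj xp|ltxp]; first by rewrite xp e_irr in epx.
  have pq : p = q.
    by apply: (@later_uniq x); rewrite // ?(e_sym x) // (ltn_trans ltxp).
  by rewrite pq ltnn in ltpq.
move=> p q x Pp Pq epx eqx; apply: h_inj; apply/eqP; rewrite eqn_leq.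
by rewrite leqNgt (aux q p x) // leqNgt (aux p q x).
Qed.

(** The parents of the vertices of [P] dominate every vertex outside [P] by
    construction, and [P] itself, where a root is given any neighbour. *)
Lemma greedy_card : #|P| = total_domination_number e.
Proof.
have [[D domD cardD] minD] := total_domination_numberP e_noiso.
apply/eqP; rewrite eqn_leq -{1}cardD (open_packing_le greedy_packing domD) /=.
pose f p := if h p < h (parent p) then parent p else xchoose (e_noiso p).
have ef p : e p (f p).
  by rewrite /f; case: ifP => [|_]; [apply: parent_edge | apply: xchooseP].
apply: leq_trans (leq_imset_card f P); apply: minD; apply/forallP=> v.
apply/exists_inP; have [Pv|/greedy_blocked[y [Py _ lty evy]]] := boolP (v \in P).
  by exists (f v); rewrite ?imset_f.
by exists (f y); rewrite ?imset_f // /f lty.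
Qed.

Definition upper : {set T} :=
  [set p in P | [exists q in P, (h q < h p) && e p q]].

(** A child in [P] of an upper vertex is not upper, since its own children block
    that vertex; and the parent map sends such children onto the upper
    vertices. *)
Lemma upper_double : (#|upper|).*2 <= #|P|.
Proof.
have [e_sym _] := e_graph.
have lowerP p q :
    p \in upper -> q \in P -> h q < h p -> e p q -> q \in P :\: upper.
  rewrite !inE => /andP[Pp _] Pq ltqp epq; rewrite Pq andbT /=.
  apply/negP=> /exists_inP[r Pr /andP[ltrq eqr]].
  have := greedy_unblocked Pp Pr (ltn_trans ltrq ltqp).
  by rewrite /blocks (@parentE r q) ?ltrq ?epq // e_sym.
suff : #|upper| <= #|P :\: upper|.
  have sub : upper \subset P by apply/subsetP=> p; rewrite inE => /andP[].
  rewrite cardsD (setIidPr sub) => le; rewrite -addnn.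
  by rewrite -(subnK (subset_leq_card sub)) leq_add2r.
apply: leq_trans (leq_imset_card parent (P :\: upper)).
apply: subset_leq_card; apply/subsetP=> p up.
have := up; rewrite inE => /andP[_ /exists_inP[q Pq /andP[ltqp epq]]].
apply/imsetP; exists q; first exact: lowerP up _ _ _.
by apply/esym/parentE; rewrite // e_sym.
Qed.

(** The neighbours of [q] are its parent and its children, and each child is
    the grandparent of some vertex of [P]: it was dominated when scanned by the
    parent of an earlier [y] in [P], and this parent is not [q], since no child
    of [q] is in [P].  The crude bound [1 + g <= 2 ^ g] makes the product over
    [q] easy. *)
Lemma lower_degree q : q \in P :\: upper ->
  #|neighbours e q| <= 2 ^ #|[set y in P | parent (parent (parent y)) == q]|.
Proof.
have [e_sym e_irr] := e_graph.
rewrite inE => /andP[lowq Pq]; set G := [set y in P | _].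
have noPq c : c \in P -> h c < h q -> ~~ e q c.
  move=> Pc ltcq; apply: contra lowq => eqc.
  by rewrite inE Pq; apply/exists_inP; exists c; rewrite ?ltcq.
suff sub : neighbours e q \subset parent q |: [set parent (parent y) | y in G].
  apply: leq_trans (ltn_expl #|G| (ltnSn 1)).
  apply: leq_trans (subset_leq_card sub) _; rewrite cardsU1.
  by apply: leq_add (leq_b1 _) (leq_imset_card _ _).
apply/subsetP=> c; rewrite !inE => eqc.
have [ltqc|] := ltnP (h q) (h c); first by rewrite (parentE eqc ltqc) eqxx.
rewrite leq_eqVlt => /predU1P[/h_inj cq|ltcq]; first by rewrite cq e_irr in eqc.
have ecq : e c q by rewrite e_sym.
apply/orP; right.
have [|y [Py ltyc lty ecy]] := @greedy_blocked c.
  by apply/negP=> Pc; have := noPq c Pc ltcq; rewrite eqc.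
have [ltc|] := ltnP (h c) (h (parent y)).
  have yq := later_uniq ecq ltcq ecy ltc.
  have := noPq y Py (ltn_trans ltyc ltcq).
  by rewrite e_sym yq parent_edge.
rewrite leq_eqVlt => /predU1P[/h_inj yc|ltxc]; first by rewrite yc e_irr in ecy.
have xc : parent (parent y) = c by apply: parentE; rewrite // e_sym.
by apply/imsetP; exists y; rewrite // inE Py xc (parentE ecq ltcq) /=.
Qed.

(** Each vertex of [P] has a single great-grandparent, so it is counted once. *)
Lemma prod_lower_degree :
  \prod_(q in P :\: upper) #|neighbours e q| <= 2 ^ #|P|.
Proof.
pose G q := [set y in P | parent (parent (parent y)) == q].
apply: (@leq_trans (\prod_(q in P :\: upper) 2 ^ #|G q|)).
  by apply: leq_prod => q; apply: lower_degree.
rewrite -expn_sum leq_pexp2l //.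
apply: (@leq_trans (\sum_q #|G q|)).
  by rewrite [leqRHS](bigID [in P :\: upper]) leq_addr.
rewrite -[#|P|]sum1_card [leqRHS](partition_big (fun y => parent (parent (parent y))) xpredT) //=.
by apply/eq_leq; apply: eq_bigr => q _; rewrite -sum1_card; apply: eq_bigl => y; rewrite inE.
Qed.

End GreedyPacking.

(** [Q] is the set of upper vertices of the greedy packing. *)
Lemma forest_min_total_dominating_sets (T : finType) (e : rel T) :
  forest e -> no_isolated_vertex e ->
  let gamma := total_domination_number e in
  exists Q : {set T},
    [/\ (#|Q|).*2 <= gamma, \sum_(p in Q) #|neighbours e p| <= #|T| &
        #|min_total_dominating_sets e| <= 2 ^ gamma * \prod_(p in Q) #|neighbours e p|].
Proof.
move=> forest_e e_noiso gamma; have [e_graph _] := forest_e.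
have [h h_inj later_uniq] := forest_elimination_order forest_e.
have [P PE] := kernel_exists h (blocks e h).
have packP := greedy_packing e_graph h_inj later_uniq PE.
have cardP := greedy_card e_graph e_noiso h_inj later_uniq PE.
have subQ : upper e h P \subset P.
  by apply/subsetP=> p; rewrite inE => /andP[].
exists (upper e h P); split.
- by rewrite /gamma -cardP; apply: upper_double.
- by apply: sum_neighbours_packing => p q x /(subsetP subQ) Pp /(subsetP subQ); apply: packP.
apply: leq_trans (min_total_dominating_sets_le_prod packP cardP) _.
rewrite (big_setID (upper e h P)) /= (setIidPr subQ) mulnC /gamma -cardP.
by rewrite leq_mul2r prod_lower_degree // orbT.
Qed.

(** * From degrees to the power of the order *)

Lemma total_domination_number_le_order (T : finType) (e : rel T) :
  total_domination_number e <= #|T|.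
Proof. exact: max_card. Qed.

Lemma total_domination_number_gt0 (T : finType) (e : rel T) :
  0 < #|T| -> no_isolated_vertex e -> 0 < total_domination_number e.
Proof.
move=> /card_gt0P[v _] /total_domination_numberP[[D /forallP/(_ v)/exists_inP[w Dw _] <-] _].
by apply/card_gt0P; exists w.
Qed.

Local Open Scope ring_scope.

(** Multiply the inequalities [d <= a * expR (d / a)].  This replaces the
    inequality between arithmetic and geometric means: [a] stands for the mean,
    but can be chosen without regard to the number of factors, of which only an
    upper bound is known. *)
Lemma prod_le_expR (R : realType) (I : finType) (Q : {set I}) (d : I -> nat) (a : R) :
  0 < a ->
  \prod_(i in Q) (d i)%:R <= a ^+ #|Q| * expR ((\sum_(i in Q) d i)%:R / a).
Proof.
move=> a_gt0; rewrite natr_sum mulr_suml expR_sum -prodr_const -big_split /=.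
apply: ler_prod => i _; rewrite ler0n /= mulrC -ler_pdivrMr //.
by apply: le_trans (expR_ge1Dx _); rewrite lerDr.
Qed.

Theorem theorem2 (R : realType) (T : finType) (e : rel T) (n gamma : nat)
    (T_gt0 : (0 < #|T|)%N)
    (order_n : #|T| = n)
    (e_forest : forest e)
    (e_noiso : no_isolated_vertex e)
    (gammaE : total_domination_number e = gamma) :
  (#|min_total_dominating_sets e|%:R : R) <=
    (8 * Num.sqrt (expR 1)) ^+ gamma *
    ((n%:R - gamma%:R / 2) / (gamma%:R / 2)) `^ (gamma%:R / 2).
Proof.
have [Q []] := forest_min_total_dominating_sets e_forest e_noiso.
have gamma_gt0 := total_domination_number_gt0 T_gt0 e_noiso.
have gamma_le := total_domination_number_le_order e.
rewrite order_n gammaE in gamma_gt0 gamma_le *.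
move=> cardQ sumQ bound.
set k : R := gamma%:R / 2; set y := (n%:R - k) / k.
have gammaR : gamma%:R = 2 * k :> R by rewrite /k mulrC divfK ?pnatr_eq0.
have k_gt0 : 0 < k by rewrite divr_gt0 ?ltr0n.
have n_ge2k : 2 * k <= n%:R by rewrite -gammaR ler_nat.
have n_le2 : n%:R <= 2 * (n%:R - k).
  by rewrite mulrBr mulr2n mulrDl mul1r -addrA lerDl subr_ge0.
have y_ge1 : 1 <= y by rewrite ler_pdivlMr // mul1r lerBrDr -mulr2n -[leLHS]mulr_natl.
have y_gt0 : 0 < y := lt_le_trans ltr01 y_ge1.
have cardQ_k : #|Q|%:R <= k by rewrite ler_pdivlMr // -natrM muln2 ler_nat.
have sqrt_e : Num.sqrt (expR 1) = expR 2^-1 :> R.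
  rewrite -[RHS]ger0_norm ?expR_ge0 // -sqrtr_sqr -expRM_natl mulfV //.
  by rewrite pnatr_eq0.
have boundR := bound; rewrite -(ler_nat R) natrM natrX natr_prod in boundR.
apply: le_trans boundR _.
have y2_gt0 : 0 < 2 * y by rewrite mulr_gt0.
(* With [a = 2 * y], the exponent [n / a] is at most [k], because
   [n <= 2 * (n - k)]; and [y >= 1] lets the exponent [#|Q|] be raised to
   [k]. *)
have prod_le : \prod_(p in Q) #|neighbours e p|%:R <= 2 ^+ gamma * (y `^ k * expR k) :> R.
  apply: le_trans (prod_le_expR Q _ y2_gt0) _.
  have y_ge0 := ltW y_gt0.
  rewrite exprMn -mulrA; apply: ler_pM; rewrite ?mulr_ge0 ?exprn_ge0 ?expR_ge0 //.
    by rewrite ler_eXn2l ?ltr1n // (leq_trans _ cardQ) // -addnn leq_addr.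
  apply: ler_pM; rewrite ?exprn_ge0 ?expR_ge0 //.
    by rewrite -powR_mulrn // ler_powR.
  rewrite ler_expR ler_pdivrMr // mulrC -mulrA divfK ?gt_eqF //.
  by apply: le_trans n_le2; rewrite ler_nat.
apply: le_trans (ler_wpM2l (exprn_ge0 _ (ler0n _ _)) prod_le) _.
rewrite [y `^ k * _]mulrC !mulrA -exprMn.
apply: ler_wpM2r; first exact: powR_ge0.
rewrite sqrt_e [leRHS]exprMn -expRM_natl -/k; apply: ler_wpM2r; first exact: expR_ge0.
by apply: lerXn2r; rewrite ?nnegrE ?mulr_ge0 // -natrM ler_nat.
Qed.
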